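(* Let $k$ be a positive integer and let $\Lambda$ be a left and right Noetherian ring. If the global dimension of $\Lambda$ is at most $k$, then each $k$-torsionfree finitely generated left $\Lambda$-module is projective.
   Context: Write $(\ )^*=\mathrm{Hom}(\ ,\Lambda)$. For a finitely generated left module $M$ with a projective presentation $P_1\xrightarrow{f}P_0\to M\to0$ by finitely generated projectives, the transpose is the right module $\mathrm{Tr}\,M=\mathrm{Coker}(f^*:P_0^*\to P_1^* )$, which is unique up to projective equivalence. $M$ is $k$-torsionfree if $\mathrm{Ext}^j_{\Lambda^{op}}(\mathrm{Tr}\,M,\Lambda)=0$ for all $1\le j\le k$. *)

(* Defs.v *)
From HB Require Import structures.
From mathcomp Require Import all_boot ssralg ring_quotient boolp.

Set Implicit Arguments.
Unset Strict Implicit.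
Unset Printing Implicit Defensive.

Import GRing.Theory.
Local Open Scope ring_scope.
Local Open Scope quotient_scope.

(* Left modules over a ring R are [lmodType R]; right R-modules are left
   modules over the converse ring, [lmodType R^c]. The regular left (resp.
   right) module is [R^o] (resp. [R^c^o]). *)

Section Modules.
Variable R : pzRingType.
Implicit Types A B P : lmodType R.

Definition finitely_generated A : Prop :=
  exists n (a : 'I_n -> A), forall x : A,
    exists c : 'I_n -> R, x = \sum_(i < n) c i *: a i.

Definition noetherian A : Prop :=
  forall S : submodClosed A, exists n (a : 'I_n -> A), forall x : A,
    x \in S <-> exists c : 'I_n -> R, x = \sum_(i < n) c i *: a i.

Definition surj A B (f : {linear A -> B}) : Prop := forall y, exists x, f x = y.

Definition exact_at A B (C : lmodType R)
    (f : {linear A -> B}) (g : {linear B -> C}) : Prop :=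
  forall y, g y = 0 <-> exists x, f x = y.

Definition projective P : Prop :=
  forall A B (g : {linear A -> B}) (h : {linear P -> B}),
    surj g -> exists f : {linear P -> A}, forall x, g (f x) = h x.

Record proj_resolution A := ProjResolution {
  res_obj :> nat -> lmodType R;
  res_d : forall i, {linear res_obj i.+1 -> res_obj i};
  res_aug : {linear res_obj 0 -> A};
  res_proj : forall i, projective (res_obj i);
  res_aug_surj : surj res_aug;
  res_exact0 : exact_at (res_d 0) res_aug;
  res_exact : forall i, exact_at (res_d i.+1) (res_d i)
}.

Definition projdim_le A (n : nat) : Prop :=
  exists X : proj_resolution A, forall i, (n < i)%N -> forall x : X i, x = 0.

Record fg_proj_presentation A := FgProjPresentation {
  pres1 : lmodType R;
  pres0 : lmodType R;
  pres_map : {linear pres1 -> pres0};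
  pres_aug : {linear pres0 -> A};
  pres1_fg : finitely_generated pres1;
  pres1_proj : projective pres1;
  pres0_fg : finitely_generated pres0;
  pres0_proj : projective pres0;
  pres_aug_surj : surj pres_aug;
  pres_exact : exact_at pres_map pres_aug
}.

End Modules.

Definition left_noetherian (R : pzRingType) : Prop := @noetherian R R^o.
Definition right_noetherian (R : pzRingType) : Prop := @noetherian R^c R^c^o.

(* This is the left global dimension; over a left and right Noetherian ring it
   agrees with the right one. *)
Definition gldim_le (R : pzRingType) (n : nat) : Prop :=
  forall A : lmodType R, projdim_le A n.

Section Hom.
Variables (R : pzRingType) (A B : lmodType R).

Definition linhom : Type := {linear A -> B}.

Lemma homP (f g : linhom) : (forall x, f x = g x) -> f = g.
Proof.
case: f g => f [[f1] [f2]] [g [[g1] [g2]]] /= /funext fg.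
rewrite {}fg in f1 f2 *.
by rewrite (Prop_irrelevance f1 g1) (Prop_irrelevance f2 g2).
Qed.

HB.instance Definition _ := gen_eqMixin linhom.
HB.instance Definition _ := gen_choiceMixin linhom.

Definition hom_of (f : A -> B) (fL : linear f) : linhom :=
  HB.pack f (GRing.isLinear.Build R A B *:%R f fL).

Fact hom_zero_linear : linear (fun _ : A => 0 : B).
Proof. by move=> a x y; rewrite scaler0 addr0. Qed.
Fact hom_opp_linear (f : linhom) : linear (fun x => - f x).
Proof. by move=> a x y; rewrite linearP opprD scalerN. Qed.
Fact hom_add_linear (f g : linhom) : linear (fun x => f x + g x).
Proof. by move=> a x y; rewrite !linearP scalerDr addrACA. Qed.

Definition hom_zero : linhom := hom_of hom_zero_linear.
Definition hom_opp f : linhom := hom_of (hom_opp_linear f).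
Definition hom_add f g : linhom := hom_of (hom_add_linear f g).

Fact hom_addA : associative hom_add.
Proof. by move=> f g h; apply: homP => x /=; rewrite addrA. Qed.
Fact hom_addC : commutative hom_add.
Proof. by move=> f g; apply: homP => x /=; rewrite addrC. Qed.
Fact hom_add0 : left_id hom_zero hom_add.
Proof. by move=> f; apply: homP => x /=; rewrite add0r. Qed.
Fact hom_addN : left_inverse hom_zero hom_opp hom_add.
Proof. by move=> f; apply: homP => x /=; rewrite addNr. Qed.

HB.instance Definition _ :=
  GRing.isZmodule.Build linhom hom_addA hom_addC hom_add0 hom_addN.

End Hom.

Section HomComp.
Variables (R : pzRingType) (A B C : lmodType R) (f : {linear A -> B}).

Definition hom_comp (g : linhom B C) : linhom A C := g \o f.

Fact hom_comp_zmod : zmod_morphism hom_comp.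
Proof. by move=> g h; apply: homP. Qed.
HB.instance Definition _ :=
  GRing.isZmodMorphism.Build (linhom B C) (linhom A C) hom_comp hom_comp_zmod.

End HomComp.

Section Dual.
Variables (R : pzRingType) (A : lmodType R).

Definition dual : Type := linhom A R^o.
HB.instance Definition _ := GRing.Zmodule.on dual.

Fact dual_scale_linear (r : R^c) (f : dual) :
  linear (fun x => (f : linhom A R^o) x * (r : R) : R^o).
Proof. by move=> a x y; rewrite linearP mulrDl -[_ *: _]/(_ * _) -mulrA. Qed.

(* (f r)(x) = f(x) r *)
Definition dual_scale (r : R^c) (f : dual) : dual :=
  hom_of (dual_scale_linear r f).

Fact dual_scaleA a b f : dual_scale a (dual_scale b f) = dual_scale (a * b) f.
Proof. by apply: homP => x /=; rewrite -mulrA. Qed.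
Fact dual_scale1 : left_id 1 dual_scale.
Proof. by move=> f; apply: homP => x /=; rewrite mulr1. Qed.
Fact dual_scaleDr : right_distributive dual_scale +%R.
Proof. by move=> a f g; apply: homP => x /=; rewrite mulrDl. Qed.
Fact dual_scaleDl f : {morph dual_scale^~ f : a b / a + b}.
Proof. by move=> a b; apply: homP => x /=; rewrite mulrDr. Qed.

HB.instance Definition _ := GRing.Zmodule_isLmodule.Build R^c dual
  dual_scaleA dual_scale1 dual_scaleDr dual_scaleDl.

End Dual.

Section DualMap.
Variables (R : pzRingType) (A B : lmodType R) (f : {linear A -> B}).

Definition dual_map (g : dual B) : dual A := hom_comp f g.

Fact dual_map_linear : linear (dual_map : dual B -> dual A).
Proof. by move=> a g h; apply: homP. Qed.
HB.instance Definition _ :=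
  GRing.isLinear.Build R^c (dual B) (dual A) *:%R dual_map dual_map_linear.

End DualMap.

Section Coker.
Variables (R : pzRingType) (A B : lmodType R) (f : {linear A -> B}).

Definition im : {pred B} := [pred y | `[< exists x, f x = y >]].

Fact im_submod : submod_closed im.
Proof.
split=> [|a y z /asboolP[x <-] /asboolP[x' <-]]; apply/asboolP.
  by exists 0; rewrite linear0.
by exists (a *: x + x'); rewrite linearP.
Qed.
HB.instance Definition _ := GRing.isSubmodClosed.Build R B im im_submod.

Definition coker : Type := Quotient.quot im.
HB.instance Definition _ := GRing.Zmodule.on coker.

Definition coker_scale (a : R) (x : coker) : coker :=
  \pi_(Quotient.quot im) (a *: repr x).

Fact coker_scale_pi a (y : B) :
  coker_scale a (\pi_(Quotient.quot im) y) = \pi_(Quotient.quot im) (a *: y).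
Proof.
apply/eqP; rewrite -Quotient.idealrBE -scalerBr rpredZ //.
by rewrite Quotient.idealrBE reprK.
Qed.

Fact coker_scaleA a b x :
  coker_scale a (coker_scale b x) = coker_scale (a * b) x.
Proof. by elim/quotW: x => y; rewrite (coker_scale_pi b) !coker_scale_pi scalerA. Qed.
Fact coker_scale1 : left_id 1 coker_scale.
Proof. by elim/quotW=> y; rewrite coker_scale_pi scale1r. Qed.
Fact coker_scaleDr : right_distributive coker_scale +%R.
Proof.
move=> a; elim/quotW=> x; elim/quotW=> y.
by rewrite -raddfD !coker_scale_pi scalerDr raddfD.
Qed.
Fact coker_scaleDl x : {morph coker_scale^~ x : a b / a + b}.
Proof. by elim/quotW: x => y a b; rewrite !coker_scale_pi scalerDl raddfD. Qed.

HB.instance Definition _ := GRing.Zmodule_isLmodule.Build R coker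
  coker_scaleA coker_scale1 coker_scaleDr coker_scaleDl.

End Coker.

(* Depends on the presentation p only up to projective equivalence. *)
Definition transpose (R : pzRingType) (A : lmodType R)
  (p : fg_proj_presentation A) : lmodType R^c := coker (dual_map (pres_map p)).

(* Ext^j(A, B) is the j-th cohomology of the complex Hom(X_*, B), where X is a
   projective resolution of A. *)
Section Ext.
Variables (R : pzRingType) (A : lmodType R) (X : proj_resolution A).
Variables (B : lmodType R) (j : nat).

Definition cocycle : {pred linhom (X j) B} :=
  [pred f | hom_comp (res_d X j) f == 0].

Definition coboundary : {pred linhom (X j) B} :=
  match j return {pred linhom (X j) B} with
  | 0 => [pred f | f == 0]
  | i.+1 => [pred f | `[< exists g : linhom (X i) B, hom_comp (res_d X i) g = f >]]
  end.

Fact cocycle_zmod : zmod_closed cocycle.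
Proof.
split=> [|f g /eqP f0 /eqP g0]; apply/eqP; first exact: raddf0.
by rewrite raddfB /= f0 g0 subrr.
Qed.
HB.instance Definition _ := GRing.isZmodClosed.Build _ cocycle cocycle_zmod.

Fact coboundary_zmod : zmod_closed coboundary.
Proof.
rewrite /coboundary; case: j => [|i]; split=> [|f g].
- exact: eqxx.
- by move=> /eqP -> /eqP ->; rewrite inE subrr.
- by apply/asboolP; exists 0; rewrite raddf0.
- move=> /asboolP[f' <-] /asboolP[g' <-]; apply/asboolP.
  by exists (f' - g'); rewrite raddfB.
Qed.
HB.instance Definition _ := GRing.isZmodClosed.Build _ coboundary coboundary_zmod.

Record cocycles : Type := Cocycle { cocycle_val :> linhom (X j) B;
                                    cocycleP : cocycle_val \in cocycle }.
HB.instance Definition _ := [isSub for cocycle_val].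
HB.instance Definition _ := [Choice of cocycles by <:].
HB.instance Definition _ := [SubChoice_isSubZmodule of cocycles by <:].

Definition coboundaries : {pred cocycles} := [pred f | val f \in coboundary].

Fact coboundaries_zmod : zmod_closed coboundaries.
Proof.
split=> [|f g]; rewrite !inE ?raddf0 ?raddfB ?rpred0 //; exact: rpredB.
Qed.
HB.instance Definition _ :=
  GRing.isZmodClosed.Build cocycles coboundaries coboundaries_zmod.

Definition Ext : zmodType := Quotient.quot coboundaries.

End Ext.

Arguments cocycle {R A} X B j _.
Arguments coboundary {R A} X B j _.
Arguments coboundaries {R A} X B j _.

(* Ext does not depend, up to isomorphism, on the resolution, and every module
   has a free resolution, so that "for all X" and "for some X" are equivalent. *)
Definition Ext_vanishes (R : pzRingType) (j : nat) (A B : lmodType R) : Prop :=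
  forall (X : proj_resolution A) (x : Ext X B j), x = 0.

(* By projective equivalence of the transposes, the choice of the presentation
   is immaterial as soon as there is one. *)
Definition torsionfree (R : pzRingType) (k : nat) (A : lmodType R) : Prop :=
  exists p : fg_proj_presentation A, forall j, (1 <= j <= k)%N ->
    Ext_vanishes j (transpose p) R^c^o.

(* Main.v *)
(* Resolve Tr M by right modules X_j, with X_0 = P1^*, X_1 = P0^*, and X_j free
   of finite rank for j >= 2, as right noetherianity allows.  The left modules
   G^j = Hom(X_j, R) form a complex beginning with P1 -> P0, and torsionfreeness
   makes it exact at G^1, ..., G^k.  Hence M = coker(G^0 -> G^1) is a k-th syzygy
   of coker(G^k -> G^{k+1}), a module of projective dimension at most k, so M is
   projective. *)
Require Import Defs.
From HB Require Import structures.
From mathcomp Require Import all_boot ssralg ring_quotient zmodp matrix boolp.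

Set Implicit Arguments.
Unset Strict Implicit.
Unset Printing Implicit Defensive.

Import GRing.Theory.
Local Open Scope ring_scope.
Local Open Scope quotient_scope.

(** * Cokernels, syzygies and projective dimension *)

Section LinearMaps.
Variable R : pzRingType.
Implicit Types A B C D K M P Q : lmodType R.

Lemma factor_surj B M D (g : {linear B -> M}) (h : {linear B -> D}) :
  surj g -> (forall x, g x = 0 -> h x = 0) ->
  exists h' : {linear M -> D}, forall x, h' (g x) = h x.
Proof.
move=> /choice[s gs] gh.
have hs x : h (s (g x)) = h x.
  apply/eqP; rewrite -subr_eq0 -(linearB h); apply/eqP/gh.
  by rewrite (linearB g) gs subrr.
have hL : linear (fun y => h (s y)).
  by move=> a x y; rewrite -(linearP h) -(hs (a *: s x + s y)) (linearP g) !gs.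
by exists (hom_of hL) => x; apply: hs.
Qed.

Lemma factor_inj K P D (i : {linear K -> P}) (h : {linear D -> P}) :
  injective i -> (forall x, exists y, i y = h x) ->
  exists h' : {linear D -> K}, forall x, i (h' x) = h x.
Proof.
move=> i_inj /choice[s is_].
have sL : linear s by move=> a x y; apply: i_inj; rewrite linearP !is_ linearP.
by exists (hom_of sL).
Qed.

(** [M] and [K] are the same quotient of [B]: each surjection factors through the other, which makes
    [M] a retract of [K]. *)
Lemma projective_same_kernel B K M (g : {linear B -> M}) (h : {linear B -> K}) :
  surj g -> surj h -> (forall x, g x = 0 <-> h x = 0) ->
  projective K -> projective M.
Proof.
move=> g_surj h_surj gh K_proj.
have [s sg] := factor_surj g_surj (fun x => (gh x).1).
have [r rh] := factor_surj h_surj (fun x => (gh x).2).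
move=> A D p q p_surj.
have [t pt] := K_proj A D p (q \o r : {linear K -> D}) p_surj.
exists (t \o s : {linear M -> A}) => x; have [y <-] := g_surj x.
by rewrite /= pt /= sg rh.
Qed.

Fact coker_pi_linear A B (f : {linear A -> B}) :
  linear (\pi_(Quotient.quot (im f)) : B -> coker f).
Proof.
by move=> a x y; rewrite raddfD; congr (_ + _); exact: esym (coker_scale_pi f a x).
Qed.

Definition coker_pi A B (f : {linear A -> B}) : {linear B -> coker f} :=
  hom_of (coker_pi_linear f).

Lemma coker_pi_surj A B (f : {linear A -> B}) : surj (coker_pi f).
Proof. by elim/quotW=> y; exists y. Qed.

Lemma coker_pi_exact A B (f : {linear A -> B}) : exact_at f (coker_pi f).
Proof.
move=> y; have E : (coker_pi f y = 0) <-> (y \in im f).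
  rewrite -[y in y \in _]subr0 Quotient.idealrBE.
  rewrite (raddf0 (\pi_(Quotient.quot (im f)))); split=> [y0|/eqP //].
  exact/eqP.
by split=> [/E/asboolP //|fx]; apply/E/asboolP.
Qed.

Definition short_exact K P A (i : {linear K -> P}) (p : {linear P -> A}) : Prop :=
  [/\ injective i, exact_at i p & surj p].

(** Since the kernel of [g] is the image of [f], [g] induces an embedding of [coker f] into [C] with
    image that of [g]. If [C] is projective, [coker f] is thus a first syzygy of [coker g]. *)
Lemma short_exact_coker A B C (f : {linear A -> B}) (g : {linear B -> C}) :
  exact_at f g -> exists i : {linear coker f -> C}, short_exact i (coker_pi g).
Proof.
move=> fg.
have [i iE] : exists i : {linear coker f -> C}, forall y, i (coker_pi f y) = g y.
  by apply: factor_surj (@coker_pi_surj _ _ f) _ => x /coker_pi_exact/fg.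
exists i; split; last exact: coker_pi_surj.
  suff i0 z : i z = 0 -> z = 0.
    by move=> y z /eqP; rewrite -subr_eq0 -linearB => /eqP/i0/subr0_eq.
  by have [y <-] := coker_pi_surj z; rewrite iE => /fg/coker_pi_exact.
move=> y; rewrite (coker_pi_exact g y); split=> [[x <-]|[z <-]].
  by exists (coker_pi f x).
by have [x <-] := coker_pi_surj z; exists x.
Qed.

(** That is, [A] is a direct summand of the sum of [A'] and a projective module: a one-sided
    projective equivalence, which suffices to compare syzygies. *)
Definition stable_retract A A' : Prop :=
  exists (u : {linear A -> A'}) (v : {linear A' -> A}) Q
    (w : {linear A -> Q}) (q : {linear Q -> A}),
    projective Q /\ forall x, x = v (u x) + q (w x).

Lemma stable_retract_projective A A' :
  stable_retract A A' -> projective A' -> projective A.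
Proof.
move=> [u [v [Q [w [q [Q_proj uvwq]]]]]] A'_proj B C g h g_surj.
have [s gs] := A'_proj _ _ g (h \o v : {linear A' -> C}) g_surj.
have [t gt] := Q_proj _ _ g (h \o q : {linear Q -> C}) g_surj.
exists ((s \o u) \+ (t \o w) : {linear A -> B}) => x /=.
by rewrite linearD gs gt /= [in RHS](uvwq x) linearD.
Qed.

(* With lifts u~, v~, q~ of u, v, q along p and p', the endomorphism
   1 - v~ u~ - q~ w p of P dies in A, hence is i h for some h : P -> K; so on K
   one gets 1 = v_K u_K + h i, which factors through P. *)
Lemma stable_retract_syzygy K P A K' P' A'
    (i : {linear K -> P}) (p : {linear P -> A})
    (i' : {linear K' -> P'}) (p' : {linear P' -> A'}) :
  short_exact i p -> short_exact i' p' -> projective P -> projective P' ->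
  stable_retract A A' -> stable_retract K K'.
Proof.
move=> [i_inj ip p_surj] [i'_inj i'p' p'_surj] P_proj P'_proj.
move=> [u [v [Q [w [q [Q_proj uvwq]]]]]].
have [ut utE] := P_proj _ _ p' (u \o p : {linear P -> A'}) p'_surj.
have [vt vtE] := P'_proj _ _ p (v \o p' : {linear P' -> A}) p_surj.
have [qt qtE] := Q_proj _ _ p q p_surj.
have pi0 x : p (i x) = 0 by apply/ip; exists x.
have p'i'0 x : p' (i' x) = 0 by apply/i'p'; exists x.
have [uK uKE] : exists uK : {linear K -> K'}, forall x, i' (uK x) = ut (i x).
  apply: (@factor_inj _ _ _ i' (ut \o i : {linear K -> P'})) => // x.
  by apply/i'p'; rewrite /= utE /= pi0 linear0.
have [vK vKE] : exists vK : {linear K' -> K}, forall x, i (vK x) = vt (i' x).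
  apply: (@factor_inj _ _ _ i (vt \o i' : {linear K' -> P})) => // x.
  by apply/ip; rewrite /= vtE /= p'i'0 linear0.
pose e : {linear P -> P} := (idfun \- (vt \o ut)) \- (qt \o (w \o p)).
have [h hE] : exists h : {linear P -> K}, forall x, i (h x) = e x.
  apply: factor_inj => // x; apply/ip.
  by rewrite /e /= !linearB vtE /= utE /= qtE {1}(uvwq (p x)) -addrA -opprD subrr.
exists uK, vK, P, i, h; split=> // x; apply: i_inj.
by rewrite linearD vKE uKE hE /e /= pi0 !linear0 addr0 addrC subrK.
Qed.

(** All choices of syzygies are quantified over, so that the property applies to syzygies that come
    from another complex than a given resolution. *)
Fixpoint syzygy_projective (n : nat) A : Prop :=
  if n is m.+1 then
    forall K P (i : {linear K -> P}) (p : {linear P -> A}),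
      short_exact i p -> projective P -> syzygy_projective m K
  else projective A.

Lemma projdim_le_syzygy A n : projdim_le A n -> syzygy_projective n A.
Proof.
move=> [X X0].
(* [coker (res_d X j)] is the [j]-th syzygy of [A] in [X]. The induction is on the number [m] of
   syzygies still to be taken. *)
suff H m j B : (m + j)%N = n -> stable_retract B (coker (res_d X j)) ->
    syzygy_projective m B.
  apply: (H n 0%N A) => //; first by rewrite addn0.
  have same x : res_aug X x = 0 <-> coker_pi (res_d X 0%N) x = 0.
    exact: iff_trans (@res_exact0 _ _ X x) (iff_sym (coker_pi_exact _ x)).
  have [u uE] := factor_surj (@res_aug_surj _ _ X) (fun x => (same x).1).
  have [v vE] := factor_surj (@coker_pi_surj _ _ _) (fun x => (same x).2).
  exists u, v, (X 0%N), \0, \0; split; first exact: res_proj.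
  by move=> x; have [y <-] := @res_aug_surj _ _ X x; rewrite uE vE /= addr0.
elim: m j B => [|m IHm] j B /=.
  (* Here [j = n], so [X j.+1] vanishes and the cokernel is [X j] itself. *)
  rewrite add0n => jn /stable_retract_projective; apply.
  apply: (@projective_same_kernel (X j) (X j) _ (coker_pi (res_d X j)) idfun).
  - exact: coker_pi_surj.
  - by move=> y; exists y.
  - move=> y; rewrite (coker_pi_exact _ y) /=; split=> [[x <-]|->].
      by rewrite (X0 j.+1 _ x) ?linear0 // jn.
    by exists 0; rewrite linear0.
  - exact: res_proj.
move=> mj B_retract K P i p ip P_proj; apply: (IHm j.+1).
  by rewrite addnS -addSn.
have [i' i'p'] := short_exact_coker (@res_exact _ _ X j).
exact: (stable_retract_syzygy ip i'p' P_proj (@res_proj _ _ X j) B_retract).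
Qed.

End LinearMaps.

(** * Finite generation over a Noetherian ring *)

Section Noetherian.
Variable R : pzRingType.
Implicit Types A B : lmodType R.

Definition submodule A (N : A -> Prop) : Prop :=
  N 0 /\ forall c x y, N x -> N y -> N (c *: x + y).

Definition lincomb A n (a : 'I_n -> A) (x : A) : Prop :=
  exists c : 'I_n -> R, x = \sum_(i < n) c i *: a i.

Lemma lincomb_submodule A n (a : 'I_n -> A) : submodule (lincomb a).
Proof.
split=> [|r x y [c ->] [d ->]].
  by exists (fun=> 0); rewrite big1 // => i _; rewrite scale0r.
exists (fun i => r * c i + d i); rewrite scaler_sumr -big_split /=.
by apply: eq_bigr => i _; rewrite scalerDl scalerA.
Qed.

Lemma submodule_sum A (N : A -> Prop) n (c : 'I_n -> R) (a : 'I_n -> A) :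
  submodule N -> (forall i, N (a i)) -> N (\sum_(i < n) c i *: a i).
Proof.
move=> [N0 N_lin] Na; apply: (big_rec N) => // i x _ Nx; exact: N_lin.
Qed.

Fact comb_map_linear A n (a : 'I_n -> A) :
  linear (fun v : 'rV[R]_n => \sum_(i < n) v 0 i *: a i).
Proof.
move=> r u v; rewrite scaler_sumr -big_split /=.
by apply: eq_bigr => i _; rewrite !mxE scalerDl scalerA.
Qed.

Definition comb_map A n (a : 'I_n -> A) : {linear 'rV[R]_n -> A} :=
  hom_of (comb_map_linear a).

Lemma comb_mapP A n (a : 'I_n -> A) x :
  lincomb a x <-> exists v, comb_map a v = x.
Proof.
split=> [[c ->]|[v <-]]; last by exists (v 0).
by exists (\row_i c i); apply: eq_bigr => i _; rewrite mxE.
Qed.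

Definition submod_closed_of A (S : {pred A}) (S_closed : submod_closed S) :
  submodClosed A := HB.pack S (GRing.isSubmodClosed.Build R A S S_closed).

Hypothesis R_noeth : left_noetherian R.

Lemma noetherian_ideal (I : R^o -> Prop) : submodule I ->
  exists n (a : 'I_n -> R^o), forall x, I x <-> lincomb a x.
Proof.
move=> [I0 I_lin].
have I_closed : submod_closed [pred x : R^o | `[< I x >]].
  by split=> [|c x y /asboolP Ix /asboolP Iy]; apply/asboolP; [|exact: I_lin].
have [n [a aP]] := R_noeth (submod_closed_of I_closed).
exists n, a => x; rewrite -[lincomb a x]aP inE.
by split=> /asboolP.
Qed.

(* Induction on n: the coefficients of a 0 in elements of N form a left ideal,
   and lifts of its generators to N together with generators of the part of N
   spanned by the other a i generate N. *)
Lemma noetherian_submodule A n (a : 'I_n -> A) (N : A -> Prop) :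
  submodule N -> (forall x, N x -> lincomb a x) ->
  exists m (b : 'I_m -> A), forall x, N x <-> lincomb b x.
Proof.
elim: n a N => [|n IHn] a N N_sub Na.
  exists 0%N, a => x; split=> [/Na //|[c ->]].
  by rewrite big_ord0; case: N_sub.
have [N0 N_lin] := N_sub.
pose a' i := a (lift ord0 i).
have [a'0 a'_lin] := lincomb_submodule a'.
have [p [r rP]] : exists p (r : 'I_p -> R^o), forall x,
    (exists2 y, lincomb a' y & N (x *: a ord0 + y)) <-> lincomb r x.
  apply: noetherian_ideal; split; first by exists 0; rewrite ?scale0r ?addr0.
  move=> c x x' [y a'y Ny] [y' a'y' Ny']; exists (c *: y + y'); first exact: a'_lin.
  by rewrite scalerDl -scalerA addrACA -scalerDr; exact: N_lin.
have /choice[s sP] l : exists y, lincomb a' y /\ N ((r l : R) *: a ord0 + y).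
  have [|y] := (rP (r l)).2; last by exists y.
  exists (fun i => (i == l)%:R); rewrite (bigD1 l) //= eqxx scale1r.
  by rewrite big1 ?addr0 // => i /negbTE ->; rewrite scale0r.
pose x l := (r l : R) *: a ord0 + s l.
have [|y [Ny a'y]|m [b bP]] := IHn a' (fun y => N y /\ lincomb a' y).
- by split=> // c y z [Ny a'y] [Nz a'z]; split; [exact: N_lin | exact: a'_lin].
- by [].
pose z (i : 'I_(p + m)) := match split i with inl l => x l | inr j => b j end.
have zE c : \sum_(i < p + m) c i *: z i =
    \sum_(l < p) c (lshift m l) *: x l + \sum_(j < m) c (rshift p j) *: b j.
  rewrite big_split_ord /=; congr (_ + _); apply: eq_bigr => i _; congr (_ *: _).
    by rewrite /z -[lshift m i]/(unsplit (inl i)) unsplitK.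
  by rewrite /z -[rshift p i]/(unsplit (inr i)) unsplitK.
exists (p + m)%N, z => y; split=> [Ny|[c ->]]; last first.
  rewrite zE -[X in X + _]scale1r; apply: N_lin.
    by apply: submodule_sum => // l; case: (sP l).
  by case/bP: (ex_intro _ _ erefl : lincomb b (\sum_(j < m) c (rshift p j) *: b j)).
have [c yE] := Na _ Ny; rewrite big_ord_recl in yE.
have a'c : lincomb a' (\sum_(i < n) c (lift ord0 i) *: a (lift ord0 i)).
  by exists (fun i => c (lift ord0 i)).
have [d cE] : lincomb r (c ord0).
  apply/rP; exists (\sum_(i < n) c (lift ord0 i) *: a (lift ord0 i)) => //.
  by rewrite -yE.
have xE : \sum_(l < p) d l *: x l = c ord0 *: a ord0 + \sum_(l < p) d l *: s l.
  rewrite cE scaler_suml -big_split /=; apply: eq_bigr => l _.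
  by rewrite scalerDr scalerA.
have /bP[e eE] : N (y - \sum_(l < p) d l *: x l) /\
    lincomb a' (y - \sum_(l < p) d l *: x l).
  rewrite addrC -scaleN1r; split.
    apply: N_lin => //; apply: submodule_sum => // l; by case: (sP l).
  rewrite xE yE scalerDr addrACA scaleN1r addNr add0r.
  apply: a'_lin => //; apply: submodule_sum; first exact: lincomb_submodule.
  by move=> l; case: (sP l).
exists (fun i => match split i with inl l => d l | inr j => e j end).
rewrite zE.
under eq_bigr do rewrite -[lshift m _]/(unsplit (inl _)) unsplitK.
under [X in _ + X]eq_bigr do rewrite -[rshift p _]/(unsplit (inr _)) unsplitK.
by rewrite -eE addrC subrK.
Qed.

(** The kernel of [f] is a submodule of a finitely generated module, hence finitely generated. This
    provides one more step of a free resolution. *)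
Lemma free_kernel_cover A B (f : {linear A -> B}) : finitely_generated A ->
  exists n (g : {linear 'rV[R]_n -> A}), exact_at g f.
Proof.
move=> [n [a aP]].
have [|x _|m [b bP]] := @noetherian_submodule A n a (fun x => f x = 0).
- split=> [|c x y fx fy]; first exact: linear0.
  by rewrite linearP fx fy scaler0 addr0.
- exact: aP.
by exists m, (comb_map b) => y; apply: iff_trans (bP y) (comb_mapP b y).
Qed.

End Noetherian.

(** * Dual bases and biduality *)

Section DualBasis.
Variable R : pzRingType.
Implicit Types A B P : lmodType R.

(** A finite dual basis exists exactly when [P] is finitely generated projective, and it passes
    explicitly to duals. *)
Definition dual_basis P n (a : 'I_n -> P) (phi : 'I_n -> {linear P -> R^o}) : Prop :=
  forall x, x = \sum_(i < n) (phi i x : R) *: a i.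

Lemma dual_basis_projective P n (a : 'I_n -> P) phi :
  dual_basis a phi -> projective P.
Proof.
move=> aphi A B g h g_surj.
have /choice[s gs] i : exists y, g y = h (a i) by exact: g_surj.
have f_lin : linear (fun x : P => \sum_(i < n) (phi i x : R) *: s i).
  move=> r u v; rewrite scaler_sumr -big_split /=.
  by apply: eq_bigr => i _; rewrite linearP scalerDl scalerA.
exists (hom_of f_lin) => x; rewrite [in RHS](aphi x) !linear_sum.
by apply: eq_bigr => i _; rewrite !linearZ /= gs.
Qed.

Lemma dual_basis_finitely_generated P n (a : 'I_n -> P) phi :
  dual_basis a phi -> finitely_generated P.
Proof. by move=> aphi; exists n, a => x; exists (phi ^~ x); apply: aphi. Qed.

Fact row_coord_linear n (i : 'I_n) : linear (fun v : 'rV[R]_n => v 0 i : R^o).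
Proof. by move=> r u v; rewrite !mxE. Qed.

Definition row_coord n (i : 'I_n) : {linear 'rV[R]_n -> R^o} :=
  hom_of (row_coord_linear i).

Lemma row_dual_basis n : dual_basis (@delta_mx R 1 n 0) (@row_coord n).
Proof. exact: row_sum_delta. Qed.

(** Projectivity splits the free cover given by the generators; the functionals are the coordinates
    of the splitting. *)
Lemma projective_dual_basis P : finitely_generated P -> projective P ->
  exists n (a : 'I_n -> P) (phi : 'I_n -> {linear P -> R^o}), dual_basis a phi.
Proof.
move=> [n [a aP]] P_proj.
have [x|s sK] := P_proj _ _ (comb_map a) (idfun : {linear P -> P}).
  exact/comb_mapP/aP.
exists n, a, (fun i => row_coord i \o s : {linear P -> R^o}) => x.
exact/esym/sK.
Qed.

End DualBasis.

(* The dual of a right module, as a left module: (r f)(y) = r f(y).  It is not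
   an instance of [dual], since R^c^c and R are not convertible. *)
Section Codual.
Variables (R : pzRingType) (Y : lmodType R^c).

Definition codual : Type := linhom Y R^c^o.
HB.instance Definition _ := GRing.Zmodule.on codual.

Fact codual_scale_linear (r : R) (f : codual) :
  linear (fun y => (r * ((f : linhom Y R^c^o) y : R) : R) : R^c^o).
Proof.
move=> a x y; rewrite linearP [LHS]mulrDr; congr (_ + _).
exact: (mulrA r ((f : linhom Y R^c^o) x : R) (a : R)).
Qed.

Definition codual_scale (r : R) (f : codual) : codual :=
  hom_of (codual_scale_linear r f).

Fact codual_scaleA a b f :
  codual_scale a (codual_scale b f) = codual_scale (a * b) f.
Proof. by apply: homP => y; exact: (mulrA a b ((f : linhom Y R^c^o) y : R)). Qed.
Fact codual_scale1 : left_id 1 codual_scale.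
Proof.
move=> f; apply: homP => y; exact: (mul1r ((f : linhom Y R^c^o) y : R)).
Qed.
Fact codual_scaleDr : right_distributive codual_scale +%R.
Proof.
move=> a f g; apply: homP => y.
exact: (mulrDr a ((f : linhom Y R^c^o) y : R) ((g : linhom Y R^c^o) y : R)).
Qed.
Fact codual_scaleDl f : {morph codual_scale^~ f : a b / a + b}.
Proof.
move=> a b; apply: homP => y; exact: (mulrDl a b ((f : linhom Y R^c^o) y : R)).
Qed.

HB.instance Definition _ := GRing.Zmodule_isLmodule.Build R codual
  codual_scaleA codual_scale1 codual_scaleDr codual_scaleDl.

End Codual.

Fact codual_map_linear (R : pzRingType) (Y Z : lmodType R^c) (f : {linear Y -> Z}) :
  linear (hom_comp f : codual Z -> codual Y).
Proof. by move=> a g h; apply: homP. Qed.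

Definition codual_map (R : pzRingType) (Y Z : lmodType R^c) (f : {linear Y -> Z}) :
  {linear codual Z -> codual Y} := hom_of (codual_map_linear f).

Fact dual_ev_linear (R : pzRingType) (P : lmodType R) (x : P) :
  linear (fun f : dual P => (f : linhom P R^o) x : R^c^o).
Proof. by []. Qed.

Definition dual_ev (R : pzRingType) (P : lmodType R) (x : P) :
  {linear dual P -> R^c^o} := hom_of (dual_ev_linear x).

Fact codual_ev_linear (R : pzRingType) (Y : lmodType R^c) (y : Y) :
  linear (fun f : codual Y => (f : linhom Y R^c^o) y : R^o).
Proof. by []. Qed.

Definition codual_ev (R : pzRingType) (Y : lmodType R^c) (y : Y) :
  {linear codual Y -> R^o} := hom_of (codual_ev_linear y).

Fact bidual_linear (R : pzRingType) (P : lmodType R) :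
  linear (@dual_ev R P : P -> codual (dual P)).
Proof. by move=> r x y; apply: homP => f; exact: (linearP (f : linhom P R^o)). Qed.

Definition bidual (R : pzRingType) (P : lmodType R) :
  {linear P -> codual (dual P)} := hom_of (@bidual_linear R P).

Section DualOfDualBasis.
Variable R : pzRingType.

Lemma sum_homE (A B : lmodType R) n (f : 'I_n -> linhom A B) x :
  (\sum_(i < n) f i) x = \sum_(i < n) f i x.
Proof. by elim/big_rec2: _ => // i y g _ <-. Qed.

(** Applying [f] to the expansion of [x] shows that functionals and generators exchange their
    roles. *)
Lemma dual_dual_basis (P : lmodType R) n (a : 'I_n -> P) phi :
  dual_basis a phi ->
  dual_basis (phi : 'I_n -> dual P) (fun i => dual_ev (a i)).
Proof.
move=> aphi f; apply: homP => x.
rewrite [in LHS](aphi x) linear_sum sum_homE.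
by apply: eq_bigr => i _; rewrite linearZ.
Qed.

End DualOfDualBasis.

Lemma codual_dual_basis (R : pzRingType) (Y : lmodType R^c) n (a : 'I_n -> Y) phi :
  dual_basis a phi ->
  dual_basis (phi : 'I_n -> codual Y) (fun i => codual_ev (a i)).
Proof.
move=> aphi f; apply: homP => x.
rewrite [in LHS](aphi x) linear_sum sum_homE.
by apply: eq_bigr => i _; rewrite linearZ.
Qed.

Lemma bidual_injective (R : pzRingType) (P : lmodType R) n (a : 'I_n -> P) phi x :
  dual_basis a phi -> bidual P x = 0 -> x = 0.
Proof.
move=> aphi x0; rewrite (aphi x) big1 // => i _.
have -> : phi i x = bidual P x (phi i) by [].
by rewrite x0 scale0r.
Qed.

(** The [phi i] generate the dual, so [t] is determined by its values on them; these are the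
    coefficients of the preimage. *)
Lemma bidual_surj (R : pzRingType) (P : lmodType R) n (a : 'I_n -> P) phi :
  dual_basis a phi -> surj (bidual P).
Proof.
move=> aphi t; exists (\sum_(i < n) (t (phi i) : R) *: a i).
apply: homP => f; rewrite [in RHS](dual_dual_basis aphi f) (linear_sum t).
rewrite -[LHS]/((f : linhom P R^o) (\sum_(i < n) (t (phi i) : R) *: a i)).
by rewrite linear_sum; apply: eq_bigr => i _; rewrite !linearZ.
Qed.

(** * Descent along an exact complex; exactness from vanishing of Ext *)

(** Exactness makes [coker (d j)] a first syzygy of [coker (d j.+1)] through [G j.+2]. Each step
    from [k] down to [0] uses up one syzygy. *)
Lemma coker_projective_descent (R : pzRingType) (G : nat -> lmodType R)
    (d : forall j, {linear G j -> G j.+1}) (k : nat) :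
  (forall j, (j < k)%N -> exact_at (d j) (d j.+1)) ->
  (forall j, (j < k)%N -> projective (G j.+2)) ->
  syzygy_projective k (coker (d k)) -> projective (coker (d 0%N)).
Proof.
elim: k => [//|k IHk] d_exact G_proj K_proj; apply: IHk => [j jk|j jk|].
- by apply: d_exact; apply: ltnW.
- by apply: G_proj; apply: ltnW.
have [i ses] := short_exact_coker (d_exact k (ltnSn k)).
exact: K_proj ses (G_proj k (ltnSn k)).
Qed.

Lemma Ext_vanishes_coboundary (R : pzRingType) (j : nat) (A B : lmodType R)
    (X : proj_resolution A) (f : linhom (X j.+1) B) :
  Ext_vanishes j.+1 A B -> hom_comp (res_d X j.+1) f = 0 ->
  exists g : linhom (X j) B, hom_comp (res_d X j) g = f.
Proof.
move=> Ext0 /eqP f_cocycle.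
pose c : cocycles X B j.+1 := Cocycle f_cocycle.
have : c \in @coboundaries R A X B j.+1.
  (* Membership of the difference [c - 0] means equality of the classes of [c] and [0] in [Ext], and
     every class is zero by [Ext0]. *)
  rewrite -[c]subr0 Quotient.idealrBE.
  by apply/eqP; rewrite [LHS]Ext0 [RHS]Ext0.
by move=> /asboolP.
Qed.

(** The complex is exact at the dual of [X j.+1], where its cohomology is [Ext] in degree [j.+1]. *)
Lemma codual_exact (R : pzRingType) (j : nat) (A : lmodType R^c)
    (X : proj_resolution A) :
  Ext_vanishes j.+1 A R^c^o ->
  exact_at (codual_map (res_d X j)) (codual_map (res_d X j.+1)).
Proof.
move=> Ext0 f; split=> [/(Ext_vanishes_coboundary Ext0) //|[g <-]].
apply: homP => x; rewrite -[LHS]/((g : linhom (X j) _) (res_d X j (res_d X j.+1 x))).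
have -> : res_d X j (res_d X j.+1 x) = 0 by apply/res_exact; exists x.
exact: linear0.
Qed.

(* Equality of arrows expresses that a differential of a resolution is a given
   map, including its source and target. *)
Record arrow (R : pzRingType) := Arrow {
  src : lmodType R; tgt : lmodType R; arr :> {linear src -> tgt} }.

(** * Resolutions with prescribed first differential *)

Section FreeResolution.
Variables (R : pzRingType) (R_noeth : left_noetherian R).

Record stage := Stage {
  stage_arrow :> arrow R;
  stage_fg : finitely_generated (src stage_arrow);
  stage_proj : projective (src stage_arrow) }.

Fact free_cover (s : stage) :
  exists p : {n & {linear 'rV[R]_n -> src s}}, exact_at (projT2 p) s.
Proof.
have [n [g gs]] := free_kernel_cover R_noeth s (stage_fg s).
by exists (existT _ n g).
Qed.

Definition next_stage (s : stage) : stage :=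
  let p := sval (cid (free_cover s)) in
  @Stage (@Arrow R _ (src s) (projT2 p))
    (dual_basis_finitely_generated (@row_dual_basis R _))
    (dual_basis_projective (@row_dual_basis R _)).

Lemma free_resolution_extending (P1 P0 A : lmodType R)
    (f : {linear P1 -> P0}) (g : {linear P0 -> A}) :
  finitely_generated P1 -> projective P1 -> projective P0 ->
  surj g -> exact_at f g ->
  exists X : proj_resolution A, Arrow (res_d X 0%N) = Arrow f /\
    forall i, exists n (a : 'I_n -> X i.+2) phi, dual_basis a phi.
Proof.
move=> P1_fg P1_proj P0_proj g_surj fg.
(* Stage [i] is the differential from [X i.+1] to [X i]. The target of stage [i.+1] is by
   computation the source of stage [i], so consecutive maps compose. *)
pose s i := iter i next_stage (@Stage (Arrow f) P1_fg P1_proj).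
have tgt_proj i : projective (tgt (s i)).
  by case: i => [|i]; [exact: P0_proj | exact: (@stage_proj (s i))].
pose X := @ProjResolution R A (fun i => tgt (s i)) (fun i => arr (s i)) g
  tgt_proj g_surj fg (fun i => svalP (cid (free_cover (s i)))).
exists X; split=> // i; exists (projT1 (sval (cid (free_cover (s i))))).
by exists (delta_mx 0), (@row_coord R _); apply: row_dual_basis.
Qed.

End FreeResolution.

(** * From the double dual of the presentation back to the module *)

(** Biduality is natural, and bijective on [pres1 p] and [pres0 p]. Hence [M] and the cokernel of
    the bidualized map are quotients of [pres0 p] by the same submodule. *)
Lemma projective_coker_bidual (R : pzRingType) (M : lmodType R)
    (p : fg_proj_presentation M) :
  projective (coker (codual_map (dual_map (pres_map p)))) -> projective M.
Proof.
have [n1 [a1 [phi1 basis1]]] :=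
  projective_dual_basis (pres1_fg p) (@pres1_proj _ _ p).
have [n0 [a0 [phi0 basis0]]] :=
  projective_dual_basis (pres0_fg p) (@pres0_proj _ _ p).
pose d := codual_map (dual_map (pres_map p)).
have d_bidual x : d (bidual _ x) = bidual _ (pres_map p x) by exact: homP.
apply: (@projective_same_kernel _ (pres0 p) _ _ (pres_aug p)
  (coker_pi d \o bidual (pres0 p))).
- exact: (@pres_aug_surj _ _ p).
- move=> z; have [y <-] := coker_pi_surj z; have [x <-] := bidual_surj basis0 y.
  by exists x.
- move=> x; apply: (iff_trans (@pres_exact _ _ p x)).
  apply: iff_sym; apply: (iff_trans (coker_pi_exact d _)).
  split=> [[y dy]|[y <-]]; last by exists (bidual _ y).
  have [z zy] := bidual_surj basis1 y; exists z.
  apply: subr0_eq; apply: (bidual_injective basis0).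
  by rewrite linearB -d_bidual zy dy subrr.
Qed.

Theorem corollary4p9 (k : nat) (R : pzRingType)
  (k_pos : (0 < k)%N)
  (R_left_noeth : left_noetherian R) (R_right_noeth : right_noetherian R)
  (R_gldim : gldim_le R k)
  (M : lmodType R) (M_fg : finitely_generated M) (M_tf : torsionfree k M) :
  projective M.
Proof.
have [p p_tf] := M_tf; apply: (@projective_coker_bidual _ _ p).
have [n1 [a1 [phi1 basis1]]] :=
  projective_dual_basis (pres1_fg p) (@pres1_proj _ _ p).
have [n0 [a0 [phi0 basis0]]] :=
  projective_dual_basis (pres0_fg p) (@pres0_proj _ _ p).
have dual1 := dual_dual_basis basis1; have dual0 := dual_dual_basis basis0.
have [X [X01 X_free]] := free_resolution_extending R_right_noeth
  (dual_basis_finitely_generated dual0) (dual_basis_projective dual0)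
  (dual_basis_projective dual1) (@coker_pi_surj _ _ _ _)
  (@coker_pi_exact _ _ _ (dual_map (pres_map p))).
(* The goal is stated as a function of the whole arrow, so that source, target and map are replaced
   at once by those of the first differential of [X]. *)
pose coker_codual (a : arrow R^c) : lmodType R := coker (codual_map a).
change (projective (coker_codual (Arrow (dual_map (pres_map p))))); rewrite -X01.
refine (@coker_projective_descent R (fun j => codual (X j))
  (fun j => codual_map (res_d X j)) k _ _ _).
(* Exactness for the index [j < k] uses [Ext] in degree [j.+1], which lies between [1] and [k]. *)
- move=> j jk; apply: codual_exact; exact: p_tf.
- move=> j _; have [n [a [phi basis]]] := X_free j.
  exact: dual_basis_projective (codual_dual_basis basis).
- exact: projdim_le_syzygy (R_gldim _).
Qed.
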